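(* Let $q\ge 3$ be a prime number. (1) There is an integer $c_q$ prime to $q$ such that $$f_q(x)\equiv c_q\,\mathrm{Li}_{1-q}\left(\frac{-x}{1-x}\right) \mod q^2.$$ (2) Let $m,n\in\mathbb{Z}$ with $m\neq 0$, and assume that $m-n\not\equiv 0\bmod q$. Then the following are equivalent. (a) $\mathrm{Li}_{1-q}\left(\frac{n}{m}\right)\in q^2\mathbb{Z}_{(q)}$. (b) $f_q\left(\frac{-n}{m-n}\right)\in q^2\mathbb{Z}_{(q)}$.
   Context: $\mathbb{Z}_{(q)}$ denotes the localization of $\mathbb{Z}$ at the prime ideal $q\mathbb{Z}$. The polynomial $f_q$ is $$f_q(x):=\sum_{t=1}^{q}\left(\sum_{\substack{1\le j,k,l\le q-1\\ k\equiv jl \bmod q}}(-1)^k\binom{t}{k}jl\right)\frac{x^t}{t}\in\mathbb{Z}_{(q)}[x],$$ where $\binom{t}{k}=0$ for $k>t$. The polylogarithm of negative index is $$\mathrm{Li}_{1-q}(x):=\left(x\frac{d}{dx}\right)^{q-1}\frac{x}{1-x}\in\mathbb{Q}(x).$$ The rational function $\mathrm{Li}_{1-q}\left(\frac{-x}{1-x}\right)$ is a polynomial in $x$ with integer coefficients; the congruence in (1) is a congruence of polynomials in $\mathbb{Z}_{(q)}[x]$, i.e. the coefficients of the difference lie in $q^2\mathbb{Z}_{(q)}$. *)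

(* Defs.v *)
From mathcomp Require Import all_boot all_order all_algebra.
From mathcomp Require Import generic_quotient.

Set Implicit Arguments.
Unset Strict Implicit.
Unset Printing Implicit Defensive.

Import Order.TTheory GRing.Theory Num.Theory.
Local Open Scope ring_scope.

Notation "p %:F" := (FracField.tofrac p) (format "p %:F") : ring_scope.

(* Z_(q) as a subring of Q: the fractions a / b with b outside q Z. *)
Definition in_Zloc (q : nat) (r : rat) : Prop :=
  exists a b : int, ~~ (q %| b)%Z /\ r = a%:~R / b%:~R.

Definition in_q2Zloc (q : nat) (r : rat) : Prop :=
  exists2 s : rat, in_Zloc q s & r = q%:R ^+ 2 * s.

(* d/dx on Q(x), by the quotient rule on the representative of F chosen by
   the quotient type; the result does not depend on that choice. *)
Definition fderiv (F : {fraction {poly rat}}) : {fraction {poly rat}} :=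
  let p := \n_(repr F) in
  let d := \d_(repr F) in
  (p^`() * d - p * d^`())%:F / (d ^+ 2)%:F.

(* Value of F in Q(x) at a point a of a field K containing Q through iota.
   F is first put in lowest terms, so that the denominator vanishes at a only
   if a is a pole; at a pole the value is 0 by the convention x / 0 = 0.
   K = Q(x) gives the substitution of one rational function into another. *)
Definition feval (K : fieldType) (iota : {rmorphism rat -> K})
    (F : {fraction {poly rat}}) (a : K) : K :=
  let p := \n_(repr F) in
  let d := \d_(repr F) in
  let g := gcdp p d in
  (map_poly iota (p %/ g)).[a] / (map_poly iota (d %/ g)).[a].

Definition Xfrac : {fraction {poly rat}} := 'X%:F.

(* Li_{1-q} *)
Definition Li (q : nat) : {fraction {poly rat}} :=
  iter (q - 1)%N (fun F => Xfrac * fderiv F) (Xfrac / (1 - Xfrac)).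

Definition Li_at (q : nat) (a : rat) : rat := feval idfun (Li q) a.

Definition Li_subst (q : nat) (G : {fraction {poly rat}}) :
  {fraction {poly rat}} := feval (@FracField.tofrac {poly rat} \o polyC) (Li q) G.

Definition f_coef (q t : nat) : rat :=
  \sum_(1 <= j < q) \sum_(1 <= k < q)
    \sum_(1 <= l < q | k == j * l %[mod q]%N)
      (-1) ^+ k * 'C(t, k)%:R * (j * l)%:R.

Definition f_poly (q : nat) : {poly rat} :=
  \sum_(1 <= t < q.+1) (f_coef q t / t%:R) *: 'X^t.

(* Main.v *)
Require Import Defs.
From mathcomp Require Import all_boot all_order all_algebra.
From mathcomp Require Import generic_quotient finfield ring.

(** In the coordinate [y = - x / (1 - x)] the function [x / (1 - x)] is [- y]
    and the operator [x d/dx] is [y (1 - y) d/dy].  So [Li_(1-q)] is a polynomial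
    [P] with integer coefficients in [y] (Lemma [Li_horner]), and the recurrence
    for its coefficients shows that the one of [y ^ t] is
    [1/t * sum_k (-1) ^ k C(t, k) k ^ q] (Lemma [liPoly_altbin]).
    Since [x |-> - x / (1 - x)] is an involution, [P] is the polynomial
    [Li_(1-q) (- x / (1 - x))].

    The coefficient of [x ^ t] in [f_q] has the same shape, with [k ^ q] replaced
    by the sum [S_k] of the products [j l] over the pairs of residues with
    [j l = k] modulo [q].  The arithmetic input is the congruence
    [S_k = S_1 k ^ q] modulo [q ^ 2] (Lemma [prodsum_cong]).  It gives
    [f_q = S_1 P] modulo [q ^ 2] (Lemma [f_poly_cong]), the denominators [t]
    being absorbed by [C(t, k) / t = C(t-1, k-1) / k].  Moreover
    [S_1] is a sum of [q - 1] numbers congruent to [1], hence is prime to [q].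

    For the second part, [Li_(1-q) (n / m) = P (z)] where
    [z = - n / (m - n)] is integral at [q]; evaluating the congruence
    at [z] shows that [f_q (z)] and [S_1 P (z)] differ by an element of
    [q ^ 2 Z_(q)], and [S_1] is a unit of [Z_(q)]. *)

Set Implicit Arguments.
Unset Strict Implicit.
Unset Printing Implicit Defensive.

Import Order.TTheory GRing.Theory Num.Theory.
Local Open Scope ring_scope.

(** * The derivation and the evaluation of rational functions *)

Lemma fraction_repr (R : idomainType) (F : {fraction R}) :
  F = (\n_(repr F))%:F / (\d_(repr F))%:F.
Proof.
rewrite -{1}[F]reprK; move: (repr F) => r.
have d0 := denom_ratioP r.
unlock FracField.tofrac.
rewrite -[_^-1]FracField.pi_inv -[RHS]FracField.pi_mul; congr (\pi _)%qT.
rewrite /FracField.mulf /FracField.invf.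
by rewrite !numden_Ratio ?oner_eq0 // mulr1 mul1r Ratio_numden.
Qed.

Lemma tofrac_div_eq (R : idomainType) (p d p' d' : R) :
  d != 0 -> d' != 0 ->
  (p%:F / d%:F == p'%:F / d'%:F :> {fraction R}) = (p * d' == p' * d).
Proof.
by move=> d0 d'0; rewrite eqr_div ?tofrac_eq0 // -!tofracM tofrac_eq.
Qed.

(** If [p / d = n / e] then [p' e + p e' = n' d + n d'], and this is exactly
    what makes the quotient rule give the same fraction on both
    representatives. *)
Lemma fderiv_frac (p d : {poly rat}) : d != 0 ->
  fderiv (p%:F / d%:F) = (p^`() * d - p * d^`())%:F / (d ^+ 2)%:F.
Proof.
move=> d0; rewrite /fderiv; set F := p%:F / d%:F.
have e0 : \d_(repr F) != 0 by apply: denom_ratioP.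
have : F = (\n_(repr F))%:F / (\d_(repr F))%:F := fraction_repr F.
move: (\n_(repr F)) (\d_(repr F)) e0 => n e e0 /eqP.
rewrite tofrac_div_eq // => /eqP pe.
apply/eqP; rewrite tofrac_div_eq ?expf_neq0 //; apply/eqP.
have dpe : p^`() * e + p * e^`() = n^`() * d + n * d^`().
  by rewrite -!derivM pe.
apply: (mulfI d0).
transitivity (d ^+ 2 * ((n^`() * d) * e - (n * d) * e^`())); first by ring.
have -> : n^`() * d = p^`() * e + p * e^`() - n * d^`() by rewrite dpe addrK.
rewrite -pe.
transitivity (d ^+ 2 * (p^`() * e ^+ 2) - d * e * (n * d) * d^`()); first by ring.
by rewrite -pe; ring.
Qed.

Local Notation const_frac := (@FracField.tofrac {poly rat} \o polyC).

Section Derivation.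

Implicit Types F G : {fraction {poly rat}}.

Lemma fderiv_tofrac (p : {poly rat}) : fderiv p%:F = (p^`())%:F.
Proof.
have := fderiv_frac p (oner_neq0 _).
rewrite expr1n tofrac1 !divr1 => ->.
by rewrite -[1]/(1%:P) derivC mulr0 subr0 mulr1.
Qed.

Lemma fderivD F G : fderiv (F + G) = fderiv F + fderiv G.
Proof.
rewrite [F]fraction_repr [G]fraction_repr.
have := denom_ratioP (repr F); have := denom_ratioP (repr G).
move: (\n_ _) (\d_ _) (\n_ _) (\d_ _) => n e p d e0 d0.
rewrite addf_div ?tofrac_eq0 // -!tofracM -tofracD.
rewrite !fderiv_frac ?mulf_neq0 // addf_div ?tofrac_eq0 ?expf_neq0 //.
rewrite -!tofracM -tofracD; apply/eqP.
rewrite tofrac_div_eq ?expf_neq0 ?mulf_neq0 ?expf_neq0 //; apply/eqP.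
by rewrite !derivE; ring.
Qed.

Lemma fderivM F G : fderiv (F * G) = fderiv F * G + F * fderiv G.
Proof.
rewrite [F]fraction_repr [G]fraction_repr.
have := denom_ratioP (repr F); have := denom_ratioP (repr G).
move: (\n_ _) (\d_ _) (\n_ _) (\d_ _) => n e p d e0 d0.
rewrite mulf_div -!tofracM !fderiv_frac ?mulf_neq0 //.
rewrite !mulf_div addf_div ?mulf_neq0 ?tofrac_eq0 ?expf_neq0 //.
rewrite -!tofracM -tofracD; apply/eqP.
rewrite tofrac_div_eq ?expf_neq0 ?mulf_neq0 ?expf_neq0 //; apply/eqP.
by rewrite !derivE; ring.
Qed.

(** The chain rule for [p o G], a consequence of [fderiv] being a derivation
    that kills constants. *)
Lemma fderiv_horner (p : {poly rat}) G :
  fderiv (map_poly const_frac p).[G]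
    = (map_poly const_frac p^`()).[G] * fderiv G.
Proof.
elim/poly_ind: p => [|p c IH].
  by rewrite deriv0 !rmorph0 horner0 mul0r -tofrac0 fderiv_tofrac deriv0.
rewrite derivD derivC addr0 derivM derivX mulr1 !rmorphD !rmorphM /=.
rewrite map_polyX map_polyC !(hornerD, hornerM, hornerX, hornerC) fderivD fderivM IH.
by rewrite [X in _ + X]fderiv_tofrac derivC tofrac0; ring.
Qed.

End Derivation.

Section Evaluation.

Variables (K : fieldType) (iota : {rmorphism rat -> K}) (a : K).

(** Unlike [feval], this relation does not ask for lowest terms: any
    representative without a pole at [a] will do.  That is why it is
    compatible with sums and products. *)
Definition has_value (F : {fraction {poly rat}}) (v : K) : Prop :=
  exists p d : {poly rat},
    [/\ F = p%:F / d%:F, (map_poly iota d).[a] != 0 &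
        v = (map_poly iota p).[a] / (map_poly iota d).[a]].

(** The reduced denominator divides every other denominator, so it cannot
    vanish at [a] when one of them does not. *)
Lemma feval_value F v : has_value F v -> feval iota F a = v.
Proof.
case=> p [d [defF da0 ->]]; rewrite /feval.
have d0 : d != 0 by apply: contraNneq da0 => ->; rewrite rmorph0 horner0.
have e0 := denom_ratioP (repr F).
have := fraction_repr F.
move: (\n_(repr F)) (\d_(repr F)) e0 => n e e0; rewrite {1}defF => /eqP.
rewrite tofrac_div_eq // => /eqP pe.
set g := gcdp n e.
have g0 : g != 0 by rewrite gcdp_eq0 negb_and e0 orbT.
have en : n = n %/ g * g by rewrite divpK // dvdp_gcdl.
have ee : e = e %/ g * g by rewrite divpK // dvdp_gcdr.
have cop : coprimep (n %/ g) (e %/ g).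
  by apply: coprimep_div_gcd; rewrite e0 orbT.
move: (n %/ g) (e %/ g) en ee cop => n' e' en ee cop.
have pe' : p * e' = n' * d.
  by apply: (mulIf g0); rewrite -mulrA -ee pe en; ring.
have /dvdpP [h dh] : e' %| d.
  by rewrite -(@Gauss_dvdpr _ d n') 1?coprimep_sym // -pe' dvdp_mull.
have e'a0 : (map_poly iota e').[a] != 0.
  by apply: contraNneq da0 => ea; rewrite dh rmorphM hornerM ea mulr0.
by apply/eqP; rewrite eqr_div // -!hornerM -!rmorphM /= pe'.
Qed.

Lemma has_value_tofrac p : has_value p%:F (map_poly iota p).[a].
Proof.
by exists p, 1; rewrite tofrac1 rmorph1 hornerE !divr1 oner_neq0.
Qed.

Lemma has_valueD F G v w :
  has_value F v -> has_value G w -> has_value (F + G) (v + w).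
Proof.
case=> p [d [-> da ->]] [n [e [-> ea ->]]].
have nz (f : {poly rat}) : (map_poly iota f).[a] != 0 -> f%:F != 0.
  by rewrite tofrac_eq0; apply: contraNneq => ->; rewrite rmorph0 horner0.
exists (p * e + n * d), (d * e).
rewrite !addf_div ?nz // !(tofracD, tofracM) !rmorphD !rmorphM !hornerE.
by rewrite mulf_neq0.
Qed.

Lemma has_valueM F G v w :
  has_value F v -> has_value G w -> has_value (F * G) (v * w).
Proof.
case=> p [d [-> da ->]] [n [e [-> ea ->]]].
exists (p * n), (d * e).
by rewrite !mulf_div !tofracM !rmorphM !hornerM mulf_neq0.
Qed.

Lemma has_value_horner (p : {poly rat}) G w :
  has_value G w ->
  has_value (map_poly const_frac p).[G] (map_poly iota p).[w].
Proof.
move=> Gw; elim/poly_ind: p => [|p c IH].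
  by have := has_value_tofrac 0; rewrite tofrac0 !rmorph0 !horner0.
rewrite !rmorphD !rmorphM /= !map_polyX !map_polyC !hornerE /=.
apply: has_valueD; first exact: has_valueM.
by have := has_value_tofrac c%:P; rewrite map_polyC hornerC.
Qed.

End Evaluation.

(** * Alternating binomial sums and the polynomial of the polylogarithm *)

(** Up to the sign [(-1) ^ t], this is the number of surjections from a set of
    [n] elements onto a set of [t] elements. *)
Definition altbin (n t : nat) : int :=
  \sum_(0 <= k < t.+1) (-1) ^+ k * 'C(t, k)%:R * k%:R ^+ n.

Lemma altbin_widen n t N : (t < N)%N ->
  altbin n t = \sum_(0 <= k < N) (-1) ^+ k * 'C(t, k)%:R * k%:R ^+ n.
Proof.
move=> ltN; rewrite /altbin [RHS](big_cat_nat (n := t.+1)) //=.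
rewrite [X in _ = _ + X]big_nat_cond [X in _ = _ + X]big1 ?addr0 //.
by move=> k /andP[/andP[ltk _] _]; rewrite bin_small // mulr0 mul0r.
Qed.

Lemma altbinS0 n : altbin n.+1 0 = 0.
Proof. by rewrite /altbin big_nat1 expr0n mulr0. Qed.

(** Since [k C(t+1,k) = (t+1) C(t,k-1)] and
    [C(t,k-1) = C(t+1,k) - C(t,k)], a factor [k] can be traded for a
    difference in [t]. *)
Lemma altbinSS n t :
  altbin n.+1 t.+1 = t.+1%:R * (altbin n t.+1 - altbin n t).
Proof.
rewrite (@altbin_widen n t t.+2) // /altbin -sumrB mulr_sumr.
apply: eq_bigr => k _.
have -> : t.+1%:R * ((-1) ^+ k * 'C(t.+1, k)%:R * k%:R ^+ n
            - (-1) ^+ k * 'C(t, k)%:R * k%:R ^+ n)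
   = (-1) ^+ k * k%:R ^+ n * (t.+1%:R * ('C(t.+1, k)%:R - 'C(t, k)%:R)) :> int
  by ring.
have -> : t.+1%:R * ('C(t.+1, k)%:R - 'C(t, k)%:R)
    = k%:R * 'C(t.+1, k)%:R :> int; last by rewrite exprS; ring.
case: k => [|k]; first by rewrite !bin0 subrr mulr0 mul0r.
by rewrite -[RHS]natrM -mul_bin_diag natrM binS natrD addrAC subrr add0r.
Qed.

Lemma altbin0S t : altbin 0 t.+1 = 0.
Proof.
transitivity ((1 - 1) ^+ t.+1 : int); last by rewrite subrr expr0n.
rewrite exprBn /altbin big_mkord; apply: eq_bigr => k _.
by rewrite !expr1n !mulr1 mulr_natr.
Qed.

(** There is no surjection onto a larger set; here it follows from the
    recurrence and from [(1 - 1) ^ (t+1) = 0]. *)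
Lemma altbin_small n t : (n < t)%N -> altbin n t = 0.
Proof.
elim: n t => [|n IH] [|t] // ltnt; first exact: altbin0S.
case: t ltnt => // t ltnt.
by rewrite altbinSS !IH ?subrr ?mulr0 // (ltnW ltnt).
Qed.

(** The polynomial that [Li_(-n)] becomes in the coordinate
    [y = - x / (1 - x)], in which [x / (1 - x)] is [- y] and [x d/dx] is
    [y (1 - y) d/dy]. *)
Definition liPoly (n : nat) : {poly int} :=
  iter n (fun P => 'X * (1 - 'X) * P^`()) (- 'X).

Lemma liPoly_coef0 n : (liPoly n)`_0 = 0.
Proof.
case: n => [|n] /=; first by rewrite coefN coefX oppr0.
by rewrite -mulrA coefXM.
Qed.

Lemma liPoly_coefS n t :
  (liPoly n.+1)`_t.+1 = (liPoly n)`_t.+1 *+ t.+1 - (liPoly n)`_t *+ t.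
Proof.
rewrite [liPoly n.+1]/= -/(liPoly n) -mulrA coefXM /= mulrBl mul1r coefB coefXM.
by case: t => [|t] /=; rewrite !coef_deriv ?mulr0n.
Qed.

(** After multiplication by [t], the coefficients satisfy the same recurrence
    as the alternating sums. *)
Lemma liPoly_altbin n t : (liPoly n)`_t *+ t = altbin n.+1 t.
Proof.
elim: n t => [|n IH] [|t]; rewrite ?mulr0n ?altbinS0 // altbinSS.
  rewrite /= coefN coefX; case: t => [|t]; last first.
    by rewrite altbin0S altbin_small // subrr mulr0 oppr0 mul0rn.
  by rewrite altbin0S /altbin big_nat1.
by rewrite liPoly_coefS !IH mulr_natl.
Qed.

(** * The polylogarithm in the coordinate - x / (1 - x) *)

Lemma oneBX_neq0 : 1 - 'X != 0 :> {poly rat}.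
Proof.
apply: contra_neq (oner_neq0 rat) => /(congr1 (horner^~ 0)).
by rewrite !hornerE.
Qed.

Lemma oneBXfrac : 1 - Xfrac = (1 - 'X)%:F.
Proof. by rewrite tofracB tofrac1. Qed.

(** These identities are kept over an abstract field: there [field] and
   unification never unfold the arithmetic of fractions of polynomials. *)
Lemma mobius_oneB (K : fieldType) (a : K) : 1 - a != 0 ->
  1 - (- a / (1 - a)) = (1 - a)^-1.
Proof. by move=> a1; field. Qed.

Lemma mobius_oneB_neq0 (K : fieldType) (a : K) : 1 - a != 0 ->
  1 - (- a / (1 - a)) != 0.
Proof. by move=> a1; rewrite mobius_oneB // invr_eq0. Qed.

Lemma mobius_invol (K : fieldType) (a : K) : 1 - a != 0 ->
  - (- a / (1 - a)) / (1 - (- a / (1 - a))) = a.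
Proof. by move=> a1; rewrite mobius_oneB // invrK; field. Qed.

Lemma mobius_euler (K : fieldType) (x : K) : 1 - x != 0 ->
  x * (- 1 / (1 - x) ^+ 2) = (- x / (1 - x)) * (1 - (- x / (1 - x))).
Proof. by move=> x1; field. Qed.

(** This is [x dy/dx = y (1 - y)] for [y = - x / (1 - x)], the identity that
    turns the Euler operator into [y (1 - y) d/dy]. *)
Lemma Xfrac_fderiv_mobius :
  Xfrac * fderiv (- Xfrac / (1 - Xfrac))
    = (- Xfrac / (1 - Xfrac)) * (1 - (- Xfrac / (1 - Xfrac))).
Proof.
have u0 : 1 - Xfrac != 0 by rewrite oneBXfrac tofrac_eq0 oneBX_neq0.
have -> : fderiv (- Xfrac / (1 - Xfrac)) = - 1 / (1 - Xfrac) ^+ 2.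
  rewrite oneBXfrac -tofracN fderiv_frac ?oneBX_neq0 // tofracXn.
  by congr (_ / _); rewrite !derivE -tofrac1 -tofracN; congr (_%:F); ring.
exact: mobius_euler.
Qed.

Lemma Li_horner q :
  Li q = (map_poly const_frac
            (map_poly intr (liPoly (q - 1)))).[- Xfrac / (1 - Xfrac)].
Proof.
rewrite /Li; elim: (q - 1)%N => [|n IH].
  rewrite /= rmorphN /= map_polyX rmorphN /= map_polyX hornerN hornerX.
  by rewrite mulNr opprK.
rewrite iterS IH fderiv_horner mulrCA Xfrac_fderiv_mobius.
rewrite [liPoly n.+1]/= -/(liPoly n) deriv_map.
move: (- Xfrac / (1 - Xfrac)) => Y.
rewrite !(rmorphM, rmorphB, rmorph1) /= !map_polyX.
by rewrite !(hornerM, hornerD, hornerN, hornerX, hornerC) [RHS]mulrC.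
Qed.

(** The only pole of [Li q] is at [1], so away from [1] it can be evaluated by
    evaluating first [y] and then the polynomial. *)
Lemma feval_Li (K : fieldType) (iota : {rmorphism rat -> K}) (a : K) q :
  1 - a != 0 ->
  feval iota (Li q) a =
    (map_poly iota (map_poly intr (liPoly (q - 1)))).[- a / (1 - a)].
Proof.
move=> a1; rewrite Li_horner; apply: feval_value; apply: has_value_horner.
exists (- 'X), (1 - 'X); rewrite oneBXfrac tofracN; split=> //.
  by rewrite rmorphB rmorph1 /= map_polyX !hornerE.
by rewrite rmorphN rmorphB rmorph1 /= !map_polyX !hornerE.
Qed.

(** The map [x |-> - x / (1 - x)] is an involution, so that substituting it
    into [Li q] leaves the bare polynomial. *)
Lemma Li_subst_mobius q :
  Li_subst q (- Xfrac / (1 - Xfrac)) = (map_poly intr (liPoly (q - 1)))%:F.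
Proof.
have u0 : 1 - Xfrac != 0 by rewrite oneBXfrac tofrac_eq0 oneBX_neq0.
rewrite /Li_subst feval_Li; last exact: (mobius_oneB_neq0 u0).
rewrite (mobius_invol u0) map_poly_comp /Xfrac horner_map; congr (_%:F).
exact: comp_polyXr.
Qed.

Lemma Li_at_quot q (m n : rat) : m != 0 -> m - n != 0 ->
  Li_at q (n / m) = (map_poly intr (liPoly (q - 1))).[- n / (m - n)].
Proof.
move=> m0 mn0; rewrite /Li_at feval_Li; last first.
  have -> : 1 - n / m = (m - n) / m by field.
  by rewrite mulf_neq0 // invr_neq0.
rewrite map_poly_id //; congr (_.[_]); field.
by rewrite m0 mn0.
Qed.

(** * Sums of products of residues modulo the square of q *)

Section Congruence.

Variable q : nat.
Hypothesis q_prime : prime q.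

Definition res (x : 'F_q) : int := (nat_of_ord x)%:Z.

(** The pairs of residues with product [y] are parametrized by their first
    member, so that a change of variable in the field exchanges the two. *)
Definition prodsum (y : 'F_q) : int :=
  \sum_(x | x != 0) res x * res (y / x).

Lemma dvdz_Fp (a : int) : (q %| a)%Z = (a%:~R == 0 :> 'F_q).
Proof. exact: dvdz_pcharf (pchar_Fp q_prime) a. Qed.

Lemma res_Fp (x : 'F_q) : (res x)%:~R = x.
Proof. by rewrite /res -pmulrn natr_Zp. Qed.

Lemma Fp_expq (x : 'F_q) : x ^+ q = x.
Proof. by rewrite -[in X in _ ^+ X](card_Fp q_prime) expf_card. Qed.

(** In the factorization of [a ^ q - b ^ q], both [a - b] and the cofactor,
    which is congruent to [q b ^ (q - 1)], are divisible by [q]. *)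
Lemma dvdz_sqr_expB (a b : int) :
  (q %| a - b)%Z -> (q%:Z ^+ 2 %| a ^+ q - b ^+ q)%Z.
Proof.
move=> dab; rewrite subrXX expr2 dvdz_mul //.
rewrite dvdz_Fp rmorph_sum /=.
have eab : a%:~R = b%:~R :> 'F_q.
  by apply/eqP; rewrite -subr_eq0 -rmorphB -dvdz_Fp.
rewrite (eq_bigr (fun=> b%:~R ^+ q.-1)) => [|i _].
  by rewrite sumr_const card_ord -mulr_natr pchar_Fp_0 // mulr0.
rewrite rmorphM !rmorphXn /= eab -exprD subnK //.
by rewrite -ltnS prednK ?prime_gt0.
Qed.

(** Let [x] and [l] be residues with product [y] modulo [q], and split
    [x l = x l ^ q + x (l - l ^ q)].
    Modulo [q ^ 2], [l ^ q] depends only on [l] modulo [q] and so equals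
    [y ^ q x' ^ q], where [x'] is the residue inverse to [x].
    In the other summand [l - l ^ q] is divisible by [q], so only [x]
    modulo [q] matters, and [x] may be replaced by [y ^ q l'], with [l']
    the residue inverse to [l].
    Summing over [x], respectively over [l], both parts are [y ^ q] times
    the corresponding parts for [y = 1]. *)
Lemma prodsum_cong (y : 'F_q) : y != 0 ->
  (q%:Z ^+ 2 %| prodsum y - res y ^+ q * prodsum 1%R)%Z.
Proof.
move=> y0.
pose fermat_gap (x : 'F_q) : int := res x - res x ^+ q.
have gap_dvd x : (q %| fermat_gap x)%Z.
  by rewrite dvdz_Fp rmorphB rmorphXn /= !res_Fp Fp_expq subrr.
pose twist (z : 'F_q) := \sum_(x | x != 0) res x * res (z / x) ^+ q.
have sum_split z : prodsum z =
    twist z + \sum_(x | x != 0) res x * fermat_gap (z / x).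
  by rewrite -big_split; apply: eq_bigr => x _; rewrite /fermat_gap /=; ring.
have twist_cong : (q%:Z ^+ 2 %| twist y - res y ^+ q * twist 1%R)%Z.
  rewrite mulr_sumr -sumrB; apply: rpred_sum => x x0.
  have -> : res x * res (y / x) ^+ q - res y ^+ q * (res x * res (1%R / x) ^+ q)
     = res x * (res (y / x) ^+ q - (res y * res (1%R / x)) ^+ q).
    by rewrite exprMn; ring.
  apply/dvdz_mull/dvdz_sqr_expB; rewrite dvdz_Fp rmorphB rmorphM /= !res_Fp.
  by rewrite mul1r subrr.
have gap_sum z : z != 0 -> \sum_(x | x != 0) res x * fermat_gap (z / x) =
    \sum_(x | x != 0) res (z / x) * fermat_gap x.
  move=> z0; have divz (x : 'F_q) : z / (z / x) = x.
    by rewrite invf_div mulrC divfK.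
  rewrite [LHS](reindex_onto (fun x => z / x) (fun x => z / x)) //=.
  apply: eq_big => [x|x /andP[x0 /eqP ->]] //.
  have [->|x0] := eqVneq x 0; first by rewrite invr0 mulr0 eqxx.
  by rewrite divz eqxx mulf_neq0 // invr_neq0.
rewrite !sum_split !gap_sum ?oner_neq0 // mulrDr opprD addrACA rpredD //.
rewrite mulr_sumr -sumrB; apply: rpred_sum => x x0.
have -> : res (y / x) * fermat_gap x - res y ^+ q * (res (1%R / x) * fermat_gap x)
   = (res (y / x) - res y ^+ q * res (1%R / x)) * fermat_gap x by ring.
rewrite expr2 dvdz_mul // dvdz_Fp rmorphB rmorphM rmorphXn /= !res_Fp Fp_expq.
by rewrite mul1r subrr.
Qed.

(** Each of the [q - 1] summands is congruent to [1]. *)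
Lemma prodsum1_Fp : (prodsum 1%R)%:~R = -1 :> 'F_q.
Proof.
rewrite rmorph_sum /= (eq_bigr (fun=> 1)) => [|x x0]; last first.
  by rewrite rmorphM /= !res_Fp mul1r divff.
rewrite sumr_const cardC1 card_Fp //; apply/eqP; rewrite eq_sym -subr_eq0.
by rewrite -opprD oppr_eq0 -mulrS prednK ?prime_gt0 // pchar_Fp_0.
Qed.

Lemma eqmod_Fp (m n : nat) : (m == n %[mod q]) = (m%:R == n%:R :> 'F_q).
Proof. by rewrite -val_eqE /= !val_Fp_nat. Qed.

(** The range [1 .. q-1] of the sums in [f_coef] is the set of least positive
    residues of the nonzero classes modulo [q]. *)
Lemma sum_Fp (V : nmodType) (P : pred nat) (F : nat -> V) :
  \sum_(1 <= i < q | P i) F i = \sum_(x : 'F_q | (x != 0) && P x) F x.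
Proof.
rewrite -[X in \sum_(1 <= _ < X | _) _](Fp_cast q_prime).
transitivity (\sum_(0 <= i < (Zp_trunc (pdiv q)).+2 | (i != 0%N) && P i) F i).
  rewrite [RHS]big_ltn_cond //= big_nat_cond [RHS]big_nat_cond.
  by apply: eq_bigl => -[|i].
by rewrite big_mkord.
Qed.

Lemma prodsum_nat (k : nat) : (0 < k < q)%N ->
  \sum_(1 <= j < q) \sum_(1 <= l < q | k == j * l %[mod q]) (j * l)%:R
    = prodsum k%:R.
Proof.
move=> /andP[k0 kq].
have k_neq0 : k%:R != 0 :> 'F_q.
  by rewrite -val_eqE /= val_Fp_nat // modn_small // -lt0n.
rewrite sum_Fp; apply: eq_big => [x|x]; first by rewrite andbT.
rewrite andbT => x0; rewrite sum_Fp (big_pred1 (k%:R / x)) => [|z].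
  by rewrite /res natrM !natz.
rewrite eqmod_Fp natrM !natr_Zp.
apply/andP/eqP => [[_ /eqP ->]|->]; first by rewrite mulrAC divff ?mul1r.
by rewrite mulrCA divff ?mulr1 // mulf_neq0 ?invr_neq0.
Qed.

End Congruence.

(** * Congruences in the localization of the rationals at q *)

Section Localization.

Variable q : nat.
Hypothesis q_prime : prime q.

Lemma ndvdz_mul (b d : int) :
  ~~ (q %| b)%Z -> ~~ (q %| d)%Z -> ~~ (q %| b * d)%Z.
Proof. by rewrite !dvdz_Fp // rmorphM; apply: mulf_neq0. Qed.

Lemma ndvdz_neq0 (b : int) : ~~ (q %| b)%Z -> b%:~R != 0 :> rat.
Proof. by rewrite intr_eq0; apply: contraNneq => ->; rewrite dvdz0. Qed.

Lemma Zloc_frac (a b : int) : ~~ (q %| b)%Z -> in_Zloc q (a%:~R / b%:~R).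
Proof. by move=> qb; exists a, b. Qed.

Lemma Zloc_int (a : int) : in_Zloc q a%:~R.
Proof.
exists a, 1; rewrite divr1 dvdz1; split=> //.
by rewrite neq_ltn prime_gt1 ?orbT.
Qed.

Lemma ZlocD r s : in_Zloc q r -> in_Zloc q s -> in_Zloc q (r + s).
Proof.
case=> a [b [qb ->]] [c [d [qd ->]]]; exists (a * d + c * b), (b * d).
split; first exact: ndvdz_mul.
by rewrite addf_div ?ndvdz_neq0 // !(intrD, intrM).
Qed.

Lemma ZlocM r s : in_Zloc q r -> in_Zloc q s -> in_Zloc q (r * s).
Proof.
case=> a [b [qb ->]] [c [d [qd ->]]]; exists (a * c), (b * d).
by split; [exact: ndvdz_mul | rewrite mulf_div !intrM].
Qed.

Lemma ZlocX r n : in_Zloc q r -> in_Zloc q (r ^+ n).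
Proof.
move=> rZ; elim: n => [|n IH]; first exact: (Zloc_int 1).
by rewrite exprS; apply: ZlocM.
Qed.

Lemma q2Zloc0 : in_q2Zloc q 0.
Proof. by exists 0; rewrite ?mulr0 //; apply: (Zloc_int 0). Qed.

Lemma q2ZlocD r s : in_q2Zloc q r -> in_q2Zloc q s -> in_q2Zloc q (r + s).
Proof.
by case=> u uZ -> [v vZ ->]; exists (u + v); rewrite ?mulrDr //; apply: ZlocD.
Qed.

Lemma q2ZlocMl r s : in_Zloc q r -> in_q2Zloc q s -> in_q2Zloc q (r * s).
Proof. by move=> rZ [v vZ ->]; exists (r * v); [apply: ZlocM | ring]. Qed.

Lemma q2ZlocN r : in_q2Zloc q r -> in_q2Zloc q (- r).
Proof.
by move=> rZ; rewrite -mulN1r; apply: q2ZlocMl => //; apply: (Zloc_int (-1)).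
Qed.

Lemma q2Zloc_dvdz (a : int) : (q%:Z ^+ 2 %| a)%Z -> in_q2Zloc q a%:~R.
Proof.
case/dvdzP=> b ->; exists b%:~R; first exact: Zloc_int.
by rewrite intrM mulrC rmorphXn.
Qed.

Lemma q2Zloc_sum (I : eqType) (s : seq I) (P : pred I) (F : I -> rat) :
  (forall i, i \in s -> P i -> in_q2Zloc q (F i)) ->
  in_q2Zloc q (\sum_(i <- s | P i) F i).
Proof.
by move=> FZ; rewrite big_seq_cond; apply: big_ind => [||i /andP[]];
   [exact: q2Zloc0 | exact: q2ZlocD | exact: FZ].
Qed.

Lemma q2Zloc_horner (p : {poly rat}) z :
  (forall i, in_q2Zloc q p`_i) -> in_Zloc q z -> in_q2Zloc q p.[z].
Proof.
move=> pZ zZ; rewrite horner_coef; apply: q2Zloc_sum => i _ _.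
by rewrite mulrC; apply: q2ZlocMl => //; apply: ZlocX.
Qed.

End Localization.

(** * Comparison of f and the polylogarithm *)

Section Coefficients.

Variable q : nat.
Hypotheses (q_prime : prime q) (q_ge3 : (3 <= q)%N).

Lemma f_coef_prodsum t :
  f_coef q t =
    (\sum_(1 <= k < q) (-1) ^+ k * 'C(t, k)%:R * @prodsum q k%:R)%:~R.
Proof.
rewrite /f_coef exchange_big_nat rmorph_sum /=; apply: eq_big_nat => k kq.
rewrite rmorphM -prodsum_nat // rmorph_sum mulr_sumr; apply: eq_bigr => j _.
rewrite rmorph_sum mulr_sumr; apply: eq_bigr => l _.
by rewrite !rmorphM /= rmorphXn rmorphN1 !rmorph_nat.
Qed.

Lemma coef_f_poly t :
  (f_poly q)`_t = if (1 <= t < q.+1)%N then f_coef q t / t%:R else 0.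
Proof.
rewrite /f_poly coef_sum -(big_nat1_eq +%R (fun t => f_coef q t / t%:R)).
rewrite [RHS]big_mkcond /=; apply: eq_bigr => s _.
rewrite coefZ coefXn eq_sym.
by case: eqP => _; rewrite ?mulr1 ?mulr0.
Qed.

Lemma liPoly_coef_rat t : (0 < t)%N ->
  ((liPoly (q - 1))`_t)%:~R = (altbin q t)%:~R / t%:R :> rat.
Proof.
move=> t0; have tn0 : t%:R != 0 :> rat by rewrite pnatr_eq0 -lt0n.
apply: (mulIf tn0); rewrite divfK // -[in altbin q t](@subnK 1 q); last exact: prime_gt0.
by rewrite addn1 -liPoly_altbin rmorphMn mulr_natr.
Qed.

(** This moves the division by [t], dangerous for [t = q], to a division by
    [k], harmless for [0 < k < q]. *)
Lemma bin_quot (t k : nat) : (0 < t)%N -> (0 < k)%N ->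
  'C(t, k)%:R / t%:R = 'C(t.-1, k.-1)%:R / k%:R :> rat.
Proof.
case: t k => [|t] [|k] // _ _; apply/eqP.
by rewrite eqr_div ?pnatr_eq0 // -!natrM mulnC -mul_bin_diag mulnC.
Qed.

(** Both coefficients at [t] are alternating binomial sums divided by [t].  The
    terms [0 < k < q] agree modulo [q ^ 2] by [prodsum_cong], even after the
    division by [t], which [bin_quot] turns into one by [k].  The polylogarithm
    has one more term, [k = q], which after division is a multiple of
    [q ^ (q - 1)], hence of [q ^ 2]. *)
Lemma f_poly_cong t :
  in_q2Zloc q
    (f_poly q - (@prodsum q 1%R)%:~R *: map_poly intr (liPoly (q - 1)))`_t.
Proof.
set c := prodsum _; have q_gt0 := prime_gt0 q_prime.
rewrite coefB coefZ coef_map /= coef_f_poly.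
case: t => [|t]; first by rewrite liPoly_coef0 mulr0 subr0; apply: q2Zloc0.
rewrite liPoly_coef_rat //; case: ifPn => [/andP[_ tq]|tq]; last first.
  (* Both polynomials have degree at most q. *)
  rewrite altbin_small; first by rewrite mul0r mulr0 subr0; apply: q2Zloc0.
  by move: tq; rewrite /= -leqNgt.
rewrite (altbin_widen q tq) big_nat_recr //= big_ltn // expr0n.
rewrite eqn0Ngt q_gt0 mulr0 add0r f_coef_prodsum.
rewrite mulrA -mulrBl -rmorphM -rmorphB mulrDr opprD addrA mulr_sumr -sumrB.
rewrite rmorphB /= mulrBl; apply: q2ZlocD => //; last first.
  (* The term k = q: C(t+1, q) / (t+1) = C(t, q-1) / q. *)
  apply: q2ZlocN => //.
  have -> : (c * ((-1) ^+ q * 'C(t.+1, q)%:R * q%:R ^+ q))%:~R / t.+1%:R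
      = (c * (-1) ^+ q * 'C(t, q.-1)%:R)%:~R * (q%:Z ^+ q.-1)%:~R :> rat.
    rewrite !intrM !rmorphXn /= !rmorph_nat -!mulrA; congr (_ * (_ * _)).
    rewrite mulrCA mulrC (@bin_quot t.+1 q) //= -mulrA; congr (_ * _).
    rewrite -[in X in _ * X](prednK q_gt0) exprS (prednK q_gt0) mulKf //.
    by rewrite pnatr_eq0 -lt0n.
  apply: q2ZlocMl => //; first exact: Zloc_int.
  apply: q2Zloc_dvdz => //; apply: dvdz_exp2l.
  (* This is 2 <= q - 1, hence the assumption that q is odd. *)
  by rewrite -ltnS prednK.
rewrite rmorph_sum mulr_suml; apply: q2Zloc_sum => // k.
rewrite mem_index_iota => /andP[k0 kq] _.
have k_neq0 : k%:R != 0 :> 'F_q.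
  by rewrite -(eqmod_Fp _ k 0) // modn_small // mod0n -lt0n.
have qk : ~~ (q %| k%:Z)%Z by rewrite dvdz_Fp // -pmulrn.
have res_k : res (k%:R : 'F_q) = k%:R.
  by rewrite /res val_Fp_nat // modn_small // natz.
set S := prodsum _.
have := prodsum_cong q_prime k_neq0.
rewrite res_k -/c -/S => /(q2Zloc_dvdz q_prime) cong_k.
have -> : ((-1) ^+ k * 'C(t.+1, k)%:R * S -
        c * ((-1) ^+ k * 'C(t.+1, k)%:R * k%:R ^+ q))%:~R / t.+1%:R
  = ((-1) ^+ k * 'C(t, k.-1)%:R)%:~R / (k%:Z)%:~R
    * (S - k%:R ^+ q * c)%:~R :> rat.
  have -> : (-1) ^+ k * 'C(t.+1, k)%:R * S -
        c * ((-1) ^+ k * 'C(t.+1, k)%:R * k%:R ^+ q)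
     = (-1) ^+ k * (S - k%:R ^+ q * c) * 'C(t.+1, k)%:R by ring.
  rewrite intrM rmorph_nat -mulrA (@bin_quot t.+1 k) // !intrM rmorph_nat.
  by rewrite -pmulrn; ring.
by apply: q2ZlocMl => //; exact: Zloc_frac.
Qed.

End Coefficients.

Theorem theorem1p5 (q : nat) (q_prime : prime q) (q_ge3 : (3 <= q)%N) :
  (exists2 P : {poly int},
     Li_subst q (- Xfrac / (1 - Xfrac)) = (map_poly intr P)%:F &
     exists2 c : int, coprimez c q &
       forall i : nat,
         in_q2Zloc q (f_poly q - c%:~R *: map_poly intr P)`_i) /\
  (forall m n : int, m != 0 -> ~~ (m - n == 0 %[mod q])%Z ->
     (in_q2Zloc q (Li_at q (n%:~R / m%:~R)) <->
      in_q2Zloc q (f_poly q).[(- n)%:~R / (m - n)%:~R])).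
Proof.
set c : int := @prodsum q 1%R; set P := liPoly (q - 1).
have cong : forall i, in_q2Zloc q (f_poly q - c%:~R *: map_poly intr P)`_i.
  exact: f_poly_cong.
have qc : ~~ (q %| c)%Z.
  by rewrite dvdz_Fp // prodsum1_Fp // oppr_eq0 oner_neq0.
split.
  exists P; first exact: Li_subst_mobius.
  by exists c; rewrite // coprimez_sym coprimezE prime_coprime.
move=> m n m0; rewrite eqz_mod_dvd subr0 => qmn.
have mn0 := ndvdz_neq0 qmn.
set z := _ / (m - n)%:~R.
have zZ : in_Zloc q z by exact: Zloc_frac.
have -> : Li_at q (n%:~R / m%:~R) = (map_poly intr P).[z].
  by rewrite Li_at_quot ?intr_eq0 // -?rmorphB // /z rmorphN.
have fz : (f_poly q).[z] =
    (f_poly q - c%:~R *: map_poly intr P).[z] + c%:~R * (map_poly intr P).[z].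
  by rewrite !hornerE subrK.
have dz := q2Zloc_horner q_prime cong zZ.
split=> [Pz | fqz].
  by rewrite fz; apply: q2ZlocD => //; apply: q2ZlocMl => //; apply: Zloc_int.
have -> : (map_poly intr P).[z] = 1%:~R / c%:~R *
    ((f_poly q).[z] - (f_poly q - c%:~R *: map_poly intr P).[z]).
  by rewrite fz addrAC subrr add0r mul1r mulKf ?(ndvdz_neq0 qc).
apply: q2ZlocMl => //; first exact: Zloc_frac.
by apply: q2ZlocD => //; apply: q2ZlocN.
Qed.
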